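(* Let $\mathcal{P}\subset\mathbb{R}^s$ be a rational polytope whose cone $\mathrm{cone}(\mathcal{P})\subset\mathbb{R}^{s+1}$ has dimension $s+1$, and let $w_1,\ldots,w_p:\mathbb{R}^s\to\mathbb{R}$ be linear weights with $w_i(\mathbb{Z}^s)\subset\mathbb{Z}$. Then the $q$-weighted multivariate Ehrhart series satisfies the reciprocity property $$F^{q,w_1,\ldots,w_p}_{\mathcal{P}}(q^{-1},t^{-1},x^{-1})=(-1)^{s+1}F^{q,w_1,\ldots,w_p}_{\mathcal{P}^{\circ}}(q,t,x),$$ as an identity of rational functions.
   Context: $\mathrm{cone}(\mathcal{P})$ is the polyhedral cone in $\mathbb{R}^{s+1}$ generated by $\{(x,1):x\in\mathcal{P}\}$ and $\mathrm{cone}(\mathcal{P})^{\circ}$ is its interior. With $t^a=t_1^{a_1}\cdots t_s^{a_s}$, $$F^{q,w_1,\ldots,w_p}_{\mathcal{P}}(q,t,x)=\sum_{(a,n)\in\mathrm{cone}(\mathcal{P})\cap\mathbb{Z}^{s+1}}q_1^{w_1(a)}\cdots q_p^{w_p(a)}t^ax^n,$$ $$F^{q,w_1,\ldots,w_p}_{\mathcal{P}^{\circ}}(q,t,x)=\sum_{(a,n)\in\mathrm{cone}(\mathcal{P})^{\circ}\cap\mathbb{Z}^{s+1}}q_1^{-w_1(-a)}\cdots q_p^{-w_p(-a)}t^ax^n .$$ Both series are identified with the rational functions they represent; $q^{-1}=(q_1^{-1},\ldots,q_p^{-1})$ and $t^{-1}=(t_1^{-1},\ldots,t_s^{-1})$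 (all variables are inverted). Linear means homogeneous linear. *)

(* Defs.v *)
From HB Require Import structures.
From mathcomp Require Import all_boot all_order all_algebra.
From mathcomp Require Import all_classical all_reals all_analysis.
(* Some notations of mpoly clash with those of MathComp-Analysis. *)
From mathcomp Require Import -(notations) mpoly.

Set Implicit Arguments.
Unset Strict Implicit.
Unset Printing Implicit Defensive.

Import Order.TTheory GRing.Theory Num.Theory.
Import numFieldNormedType.Exports.

Local Open Scope classical_set_scope.
Local Open Scope ring_scope.

Section Polyhedra.
Variable R : realType.

Definition convex_hull n (V : seq 'rV[R]_n) : set 'rV[R]_n :=
  [set x | exists l : 'I_(size V) -> R,
    [/\ forall i, 0 <= l i, \sum_i l i = 1 & x = \sum_i l i *: V`_i]].

Definition rational_polytope n (P : set 'rV[R]_n) : Prop :=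
  exists V : seq 'rV[rat]_n, P = convex_hull (map (map_mx ratr) V).

Definition conic_hull n (G : set 'rV[R]_n) : set 'rV[R]_n :=
  [set y | exists k (g : 'I_k -> 'rV[R]_n) (l : 'I_k -> R),
    [/\ forall i, G (g i), forall i, 0 <= l i & y = \sum_i l i *: g i]].

Definition cone s (P : set 'rV[R]_s) : set 'rV[R]_(s + 1) :=
  conic_hull [set row_mx x 1%:M | x in P].

(* The dimension of a cone is that of the linear subspace it spans. *)
Definition cone_dim n (C : set 'rV[R]_n) (d : nat) : Prop :=
  exists U : {vspace 'rV[R]_n},
    [/\ C `<=` [set` U],
        forall U' : {vspace 'rV[R]_n}, C `<=` [set` U'] -> (U <= U')%VS
      & \dim U = d].

Definition lattice_points n (A : set 'rV[R]_n) : set 'rV[int]_n :=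
  [set u | A (map_mx intr u)].

End Polyhedra.

(* A formal series in the variables y_i and their inverses is given by its
   family of coefficients, indexed by integer exponent vectors. *)
Definition fseries m := 'rV[int]_m -> rat.

(* \sum_(u in S) y ^ (e u). Finitely supported sums default to 0 on infinite
   supports, so this is meaningful when e has finite fibres on S; below, e is
   injective. *)
Definition monomial_series k m (S : set 'rV[int]_k)
    (e : 'rV[int]_k -> 'rV[int]_m) : fseries m :=
  fun z => \sum_(u \in [set u | S u /\ e u = z]) (1 : rat).

Definition ratfun m : fieldType := {fraction (mpoly m rat)}.

Section RationalFunctions.
Variable m : nat.

Local Notation mpolQ := (mpoly m rat).
Local Notation "x %:F" := (FracField.tofrac x).

Definition mexp (d : multinom m) : 'rV[int]_m := \row_i (d i)%:Z.

Definition fseries_of_mpoly (p : mpolQ) : fseries m :=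
  fun z => \sum_(d <- msupp p | mexp d == z) mcoeff d p.

Definition mul_fseries (p : mpolQ) (c : fseries m) : fseries m :=
  fun z => \sum_(d <- msupp p) mcoeff d p * c (z - mexp d).

(* c represents f when f = N / D with D nonzero and D * c = N. Such an f is
   unique, since D * c = N and D' * c = N' give D' * N = D * N'. *)
Definition represents (c : fseries m) (f : ratfun m) : Prop :=
  exists N D : mpolQ,
    [/\ D != 0, f = N%:F / D%:F
      & mul_fseries D c = fseries_of_mpoly N].

Definition mpoly_inv_vars (p : mpolQ) : ratfun m :=
  mmap (fun c : rat => (mpolyC m c)%:F)
    (fun i : 'I_m => (mpolyX rat (mnm1 i))%:F^-1) p.

(* f(y_1^-1, ..., y_m^-1). The value does not depend on the chosen fraction,
   because mpoly_inv_vars is an injective ring morphism. *)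
Definition inv_vars (f : ratfun m) : ratfun m :=
  mpoly_inv_vars (frac (repr f)).1 / mpoly_inv_vars (frac (repr f)).2.

End RationalFunctions.

Section EhrhartSeries.
Variables (R : realType) (s p : nat).
Variable w : 'I_p -> {scalar 'rV[R]_s}.

(* On weights with integer values at integer points the floor is exact. *)
Definition weights (a : 'rV[int]_s) : 'rV[int]_p :=
  \row_i Num.floor (w i (map_mx intr a)).

(* The p + (s + 1) variables are q_1, ..., q_p, t_1, ..., t_s, x, in this
   order, and a lattice point u = (a, n) has a = lsubmx u. *)
Definition ehrhart_series (P : set 'rV[R]_s) : fseries (p + (s + 1)) :=
  monomial_series (lattice_points (cone P))
    (fun u => row_mx (weights (lsubmx u)) u).

Definition ehrhart_series_interior (P : set 'rV[R]_s) : fseries (p + (s + 1)) :=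
  monomial_series (lattice_points (interior (cone P)))
    (fun u => row_mx (- weights (- lsubmx u)) u).

End EhrhartSeries.

(* Main.v *)
Require Import Defs.
From mathcomp Require Import all_boot all_order all_algebra.
From mathcomp Require Import all_classical all_reals all_analysis.
From mathcomp Require Import ring lra zify.
From mathcomp Require ssrcomplements.
From mathcomp Require Import -(notations) mpoly.

Set Implicit Arguments.
Unset Strict Implicit.
Unset Printing Implicit Defensive.

Import Order.TTheory GRing.Theory Num.Theory.
Import numFieldNormedType.Exports.

Local Open Scope ring_scope.

(** The two Ehrhart series are sums over the lattice points of the cone K over
    the polytope, and of its interior, transported by an injective linear map
    u |-> (w(u), u) to the exponents. The cone is generated by finitely many
    integer vectors v_j that span the space, and the identity follows by cutting
    it into half-open simplicial cones.

    The cutting is done by linear programming. Give each generator v_j a height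
    h_j and write a point x of K as a nonnegative combination of generators of
    least total height. A dual feasible basis is optimal for every x in its
    simplicial cone, and dual feasibility is a condition on the heights that does
    not involve x. For generic heights every x in K lies in the simplicial cone
    of some dual feasible basis, by the dual simplex method ([cell_exists]), and
    of only one if x avoids the walls, by complementary slackness
    ([regular_cell_sub]).

    The walls are handled by a shift. Let b be a positive combination of all
    generators, in general position. For small e > 0, x lies in K iff x + e b
    does, and x is interior to K iff x - e b lies in K ([interior_generated]).
    The points x + e b and x - e b avoid all walls, and the cells in which they
    lie are read off the signs of the coordinates of x and, where these vanish,
    of b. So both K and its interior are disjoint unions of half-open simplicial
    cones on the same bases, where a facet is kept for K iff it is removed for
    the interior ([half_open_decomposition]).

    For one basis the reciprocity is an explicit computation. Multiplying the
    series of the half-open cone by 1 - y^a, where a is the exponent of a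
    generator, cuts the coordinate on that generator down to [0, 1) or (0, 1];
    multiplying the series of the opposite half-open cone by y^-a - 1 cuts the
    coordinate down to the negated interval. After s + 1 such steps two finite
    sums are left that are exchanged by inverting the variables, and undoing a
    step costs the factor 1 / (1 - y^-a) = - y^a / (1 - y^a), that is, one sign
    ([reciprocal_difference], [reciprocal_truncated]). *)

(** * Bases among the generators of a cone *)

Section Charts.
Variables (R : realFieldType) (r d : nat) (V : 'M[R]_(r, d)).

(** A basis of the ambient space chosen among the rows of V, given by its index
    set B together with the matrix C that sends x to its coordinates on the
    rows of V, extended by 0 outside B. All bases then share one coordinate
    space, and exchanging a generator requires no reindexing. *)
Definition is_chart (B : {set 'I_r}) (C : 'M[R]_(d, r)) : Prop :=
  [/\ C *m V = 1%:M, forall i j, j \notin B -> C i j = 0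
    & forall j k, j \in B -> (V *m C) j k = (j == k)%:R].

(** From C' V = 1 one gets C = C' V C, and C' V C = C' since C' is supported on
    the columns in B, and the rows of V C in B are those of the identity. *)
Lemma is_chart_uniq B C C' : is_chart B C -> is_chart B C' -> C = C'.
Proof.
move=> [CV1 _ rowC] [C'V1 zC' rowC'].
rewrite -[C]mul1mx -C'V1 -mulmxA; apply/matrixP=> i k; rewrite mxE.
rewrite (bigD1_ord k) //=.
have [kB|kB] := boolP (k \in B).
  rewrite rowC // eqxx mulr1 big1 ?addr0 // => j _.
  have [jB|/zC'->] := boolP (lift k j \in B); last by rewrite mul0r.
  by rewrite rowC // eq_sym (negPf (neq_lift _ _)) mulr0.
rewrite zC' // mul0r add0r big1 // => j _.
have [jB|/zC'->] := boolP (lift k j \in B); last by rewrite mul0r.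
by rewrite rowC // eq_sym (negPf (neq_lift _ _)) mulr0.
Qed.

Definition chart (B : {set 'I_r}) : 'M[R]_(d, r) :=
  xget 0 [set C | is_chart B C]%classic.

Definition is_basis (B : {set 'I_r}) : bool := `[< is_chart B (chart B) >].

Lemma is_chart_basis B C : is_chart B C -> is_basis B /\ chart B = C.
Proof.
move=> BC; have BchB : is_chart B (chart B) by exact: (xgetI _ BC).
by split; [apply/asboolP | apply: is_chart_uniq BchB BC].
Qed.

Lemma chartK B : is_basis B -> chart B *m V = 1%:M.
Proof. by move=> /asboolP[]. Qed.

Lemma chart_out B i j : is_basis B -> j \notin B -> chart B i j = 0.
Proof. by move=> /asboolP[_ + _]; apply. Qed.

Lemma chart_gen B j k : is_basis B -> j \in B ->
  (V *m chart B) j k = (j == k)%:R.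
Proof. by move=> /asboolP[_ _ +]; apply. Qed.

Lemma coord_out n (X : 'M[R]_(n, d)) B a j : is_basis B -> j \notin B ->
  (X *m chart B) a j = 0.
Proof. by move=> hB hj; rewrite mxE big1 // => i _; rewrite chart_out // mulr0. Qed.

(** Compare the traces of C V, the identity of dimension d, and of V C, whose
    diagonal is the indicator of B. *)
Lemma card_basis B : is_basis B -> #|B| = d.
Proof.
move=> hB; apply/eqP; rewrite -(eqr_nat R) -[d%:R](mxtrace1 R d) -(chartK hB).
rewrite mxtrace_mulC /mxtrace (bigID (mem B)) /=.
rewrite [X in _ + X]big1 ?addr0 => [|j hj]; last by rewrite coord_out.
rewrite (eq_bigr (fun=> 1)) ?sumr_const // => j hj.
by rewrite chart_gen // eqxx.
Qed.

(** The rank-one change of coordinates that puts generator j in place of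
    generator i. *)
Definition pivot (C : 'M[R]_(d, r)) (i j : 'I_r) : 'M[R]_(d, r) :=
  C - ((V *m C) j i)^-1 *: (col i C *m (row j (V *m C) - delta_mx 0 j)).

Lemma coord_pivot n (X : 'M[R]_(n, d)) C i j a k :
  (X *m pivot C i j) a k =
  (X *m C) a k - (X *m C) a i / (V *m C) j i * ((V *m C) j k - (j == k)%:R).
Proof.
rewrite /pivot mulmxBr -scalemxAr colE !mulmxA -colE.
set Y := X *m C; set W := V *m C.
rewrite mxE [X in _ + X]mxE [X in - X]mxE [X in - (_ * X)]mxE big_ord1 !mxE.
by rewrite eqxx /= mulrCA !mulrA [k == j]eq_sym.
Qed.

Lemma is_chart_pivot B C i j : is_chart B C -> i \in B -> j \notin B ->
  (V *m C) j i != 0 -> is_chart (j |: B :\ i) (pivot C i j).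
Proof.
move=> [CV1 zC rowC] iB jB ci; have ij : i != j by apply: contraNneq jB => <-.
split.
- rewrite mulmxBl CV1 -scalemxAl -mulmxA mulmxBl -row_mul -mulmxA CV1 mulmx1.
  by rewrite -rowE subrr mulmx0 scaler0 subr0.
- move=> a k; rewrite !inE negb_or negb_and negbK => /andP[kj kiB].
  rewrite -[pivot _ _ _]mul1mx coord_pivot mul1mx [j == k]eq_sym (negPf kj) subr0.
  case/orP: kiB => [/eqP->|kB]; first by rewrite mulfVK ?subrr.
  rewrite zC // sub0r; have -> : (V *m C) j k = 0.
    by rewrite mxE big1 // => b _; rewrite zC // mulr0.
  by rewrite mulr0 oppr0.
- move=> k l; rewrite !inE coord_pivot => /orP[/eqP->|/andP[ki kB]].
    by rewrite divff // mul1r opprB addrC subrK.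
  by rewrite !(rowC k) // (negPf ki) !mul0r subr0.
Qed.

(** How the value of a linear objective h changes under a pivot: the
    coordinate on the leaving generator times the reduced cost of the entering
    one, divided by the pivot element. *)
Lemma value_pivot n (X : 'M[R]_(n, d)) C i j (h : 'cV[R]_r) a :
  (X *m pivot C i j *m h) a 0 = (X *m C *m h) a 0
    + (X *m C) a i / (V *m C) j i * (h - V *m C *m h) j 0.
Proof.
have -> : (h - V *m C *m h) j 0 =
    \sum_l ((j == l)%:R - (V *m C) j l) * h l 0.
  have -> : h - V *m C *m h = (1%:M - V *m C) *m h by rewrite mulmxBl mul1mx.
  rewrite mxE; apply: eq_bigr => l _.
  by rewrite mxE [X in X + _]mxE [X in _ + X]mxE.
rewrite [LHS]mxE [X in _ = X + _]mxE mulr_sumr -big_split /=.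
apply: eq_bigr => l _; rewrite coord_pivot; ring.
Qed.

Lemma exists_basis : row_full V -> exists B, is_basis B.
Proof.
move=> fV; set f := fullrankfun fV; set U := rowsub f V.
have Uu : U \in unitmx by rewrite -row_full_unit; exact: fullrowsub_full.
pose P : 'M[R]_(d, r) := \matrix_(i, j) (f i == j)%:R.
have PV : P *m V = U.
  apply/row_matrixP => i; rewrite row_mul row_rowsub [row (f i) V]rowE; congr (_ *m _).
  by apply/rowP => j; rewrite !mxE eqxx eq_sym.
suff : is_chart [set f i | i : 'I_d] (invmx U *m P).
  by case/is_chart_basis; eexists; eassumption.
split; first by rewrite -mulmxA PV mulVmx.
- move=> i j hj; rewrite mxE big1 // => k _; rewrite !mxE.
  by case: eqP => [e|]; rewrite ?mulr0 //; case/negP: hj; apply/imsetP; exists k.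
- move=> j k /imsetP[i _ ->]; have -> : (V *m (invmx U *m P)) (f i) k = P i k.
    have <- : row i (U *m (invmx U *m P)) 0 k = (V *m (invmx U *m P)) (f i) k.
      by rewrite row_mul row_rowsub -row_mul mxE.
    by rewrite mulmxA mulmxV // mul1mx mxE.
  by rewrite mxE.
Qed.

End Charts.

(** * A regular triangulation by linear programming *)

Section Triangulation.
Variables (R : realFieldType) (r d : nat) (V : 'M[R]_(r, d)).
Implicit Types (B : {set 'I_r}) (h : 'cV[R]_r) (x : 'rV[R]_d).

Local Notation chart := (chart V).
Local Notation is_basis := (is_basis V).

Definition generated x := exists2 mu : 'rV[R]_r,
  forall j, 0 <= mu 0 j & x = mu *m V.

(** The reduced cost of generator j for the heights h: how far the lifted
    generator (v_j, h_j) lies above the hyperplane through the lifted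
    generators of the basis B. *)
Definition slack h B : 'cV[R]_r := h - V *m chart B *m h.

Definition generic_heights h :=
  forall B j, is_basis B -> slack h B j 0 = 0 -> j \in B.

(** The lower hull of the lifted generators: bases that are dual feasible, a
    condition that involves h but no point x. *)
Definition regular_cell h B :=
  is_basis B && [forall j, 0 <= slack h B j 0].

Definition in_cell B x := [forall j, 0 <= (x *m chart B) 0 j].

Lemma in_cell_generated B x : is_basis B -> in_cell B x -> generated x.
Proof.
move=> hB /forallP xB; exists (x *m chart B) => //.
by rewrite -mulmxA chartK // mulmx1.
Qed.

Definition cost h B x := (x *m chart B *m h) 0 0.

(** Any way to write x on the generators costs at least as much as the basis B
    does, the excess being weighted by the slacks: weak duality and
    complementary slackness in one identity. *)
Lemma cost_generated h B x mu : x = mu *m V ->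
  cost h B x = (mu *m h) 0 0 - \sum_j mu 0 j * slack h B j 0.
Proof.
move=> ->; have -> : \sum_j mu 0 j * slack h B j 0 = (mu *m slack h B) 0 0.
  by rewrite mxE.
by rewrite /slack mulmxBr /cost !mulmxA [X in _ = _ - X]mxE [X in _ - (_ + X)]mxE subKr.
Qed.

(** Dual simplex: among the dual feasible bases take one where the cost of x is
    maximal. If x had a negative coordinate i there, some generator would have a
    negative coordinate i as well, since x is a nonnegative combination of
    generators; the dual ratio test selects such a generator to enter, and the
    pivot keeps feasibility and strictly raises the cost. *)
Lemma cell_exists h B0 x : generic_heights h -> regular_cell h B0 ->
  generated x -> exists2 B, regular_cell h B & in_cell B x.
Proof.
move=> gen_h reg0 [mu mu_ge0 xE].
case: (arg_maxP (fun B => cost h B x) reg0) => B /andP[hB /forallP slB] maxB.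
exists B; first by rewrite /regular_cell hB; apply/forallP.
apply/forallP => i; rewrite leNgt; apply/negP => xi_lt0.
have iB : i \in B by apply: contraTT xi_lt0 => iB; rewrite coord_out // ltxx.
pose neg j := (V *m chart B) j i < 0.
have [j0 negj0] : exists j, neg j.
  apply/existsP; apply: contraTT xi_lt0 => /existsPn nonneg.
  rewrite -leNgt xE -mulmxA mxE sumr_ge0 // => j _.
  by rewrite mulr_ge0 // leNgt; exact: nonneg.
(* The entering generator minimizes the dual ratio, so that no slack becomes
   negative. *)
pose ratio j := slack h B j 0 / - (V *m chart B) j i.
case: (arg_minP ratio negj0) => j negj minj.
have jB : j \notin B.
  by apply: contraTN negj => jB; rewrite /neg chart_gen // -leNgt ler0n.
have chB' := is_chart_pivot (asboolP _ hB) iB jB (ltr0_neq0 negj).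
have [hB' chB'E] := is_chart_basis chB'.
set B' := j |: B :\ i in chB' hB' chB'E.
have slack_gt0 : 0 < slack h B j 0.
  rewrite lt_neqAle slB andbT eq_sym; apply/eqP => /(gen_h _ _ hB).
  by rewrite (negPf jB).
have : regular_cell h B'.
  rewrite /regular_cell hB'; apply/forallP => k.
  rewrite /slack chB'E mxE [X in _ + X]mxE value_pivot.
  have -> : h k 0 - ((V *m chart B *m h) k 0
      + (V *m chart B) k i / (V *m chart B) j i * slack h B j 0) =
    slack h B k 0 - (V *m chart B) k i * (slack h B j 0 / (V *m chart B) j i).
    rewrite [slack h B k 0]mxE [X in _ = _ + X - _]mxE; ring.
  have [negk|] := ltP ((V *m chart B) k i) 0.
    have := minj k negk; rewrite /ratio ler_pdivlMr ?oppr_gt0 // invrN.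
    lra.
  move=> posk; rewrite subr_ge0 (le_trans _ (slB k)) //.
  by rewrite mulr_ge0_le0 // mulr_ge0_le0 ?slB // invr_le0 ltW.
move=> /maxB; rewrite /= /cost chB'E value_pivot leNgt ltrDl.
by rewrite mulr_gt0 // nmulr_rgt0 // invr_lt0.
Qed.

(** Both cells give the same minimal cost, so by complementary slackness every
    generator used with a nonzero coefficient in one has slack 0 in the other,
    hence belongs to the other basis when the heights are generic. *)
Lemma regular_cell_sub h B B' x : generic_heights h ->
  regular_cell h B -> regular_cell h B' -> in_cell B x -> in_cell B' x ->
  (forall j, j \in B' -> (x *m chart B') 0 j != 0) -> B' \subset B.
Proof.
move=> gen_h /andP[hB /forallP slB] /andP[hB' /forallP slB'].
move=> /forallP xB /forallP xB' gen_x.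
have costB : cost h B x = cost h B' x - \sum_j (x *m chart B') 0 j * slack h B j 0.
  by apply: cost_generated; rewrite -mulmxA chartK ?mulmx1.
have costB' : cost h B' x = cost h B x - \sum_j (x *m chart B) 0 j * slack h B' j 0.
  by apply: cost_generated; rewrite -mulmxA chartK ?mulmx1.
have ge0 : 0 <= \sum_j (x *m chart B) 0 j * slack h B' j 0.
  by apply: sumr_ge0 => j _; rewrite mulr_ge0.
have ge0' j : true -> 0 <= (x *m chart B') 0 j * slack h B j 0 by rewrite mulr_ge0.
have : \sum_j (x *m chart B') 0 j * slack h B j 0 <= 0 by lra.
rewrite le_eqVlt ltNge sumr_ge0 ?orbF // => /eqP/psumr_eq0P sl0.
apply/fintype.subsetP => j jB'; apply: gen_h => //.
have /eqP := sl0 ge0' j isT.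
by rewrite mulf_eq0 (negPf (gen_x _ jB')) => /eqP.
Qed.

Definition generic_point x :=
  forall B j, is_basis B -> j \in B -> (x *m chart B) 0 j != 0.

Lemma cell_count h B0 x : generic_heights h -> regular_cell h B0 ->
  generic_point x ->
  (\sum_(B | regular_cell h B) in_cell B x)%N = `[< generated x >].
Proof.
move=> gen_h reg0 gen_x; have [gx|ngx] := asboolP (generated x).
  have [B regB xB] := cell_exists gen_h reg0 gx.
  rewrite (bigD1 B) //= xB big1 // => B' /andP[regB' /negPf B'B].
  apply/eqP; rewrite eqb0; apply: contraFN B'B => xB'.
  have [hB _] := andP regB; have [hB' _] := andP regB'.
  rewrite finset.eqEsubset (regular_cell_sub gen_h regB regB' xB xB') => [|j];
    last exact: gen_x.
  by rewrite (regular_cell_sub gen_h regB' regB xB' xB) // => j; exact: gen_x.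
rewrite big1 // => B /andP[hB _]; apply/eqP; rewrite eqb0.
by apply/negP => xB; apply: ngx; exact: in_cell_generated xB.
Qed.

End Triangulation.

(** * Generic choices and the half-open decomposition *)

Section GenericChoice.
Variable R : realFieldType.

(** The product q of the polynomials is nonzero, so it does not vanish at all
    of 1, 2, .., size q. Genericity is always obtained from this, with heights
    and points taken on a moment curve. *)
Lemma exists_common_nonroot (I : finType) (P : pred I) (p : I -> {poly R}) :
  (forall i, P i -> p i != 0) ->
  exists2 t, 0 < t & forall i, P i -> (p i).[t] != 0.
Proof.
move=> p_neq0; pose q := \prod_(i | P i) p i.
have q_neq0 : q != 0 by apply/prodf_neq0.
pose rs := [seq k.+1%:R : R | k <- iota 0 (size q)].
have /allPn[t /mapP[k _ ->] qt] : ~~ all (root q) rs.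
  apply/negP => rs_root; have := max_poly_roots q_neq0 rs_root.
  rewrite map_inj_uniq ?iota_uniq => [/(_ isT)|x y /eqP].
    by rewrite size_map size_iota ltnn.
  by rewrite eqr_nat eqSS => /eqP.
exists k.+1%:R; first by rewrite ltr0n.
move=> i Pi; apply: contra qt => /eqP pi0.
by rewrite rootE horner_prod (bigD1 i) //= pi0 mul0r.
Qed.

Lemma exists_common_small (I : finType) (Q : I -> R -> Prop) :
  (forall i, exists2 e0, 0 < e0 & forall e, 0 < e -> e <= e0 -> Q i e) ->
  exists2 e0, 0 < e0 & forall e, 0 < e -> e <= e0 -> forall i, Q i e.
Proof.
move=> Qsmall.
have [e0 e0_gt0 Qe0] : exists2 e0, 0 < e0 &
    forall e, 0 < e -> e <= e0 -> forall i, i \in enum I -> Q i e.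
  elim: (enum I) => [|i s [e1 e1_gt0 IH]]; first by exists 1.
  have [e2 e2_gt0 Qi] := Qsmall i; exists (Num.min e1 e2).
    by rewrite lt_min e1_gt0.
  move=> e e_gt0; rewrite le_min => /andP[ee1 ee2] k.
  by rewrite inE => /predU1P[->|]; [exact: Qi | exact: IH].
by exists e0 => // e e_gt0 ee0 i; apply: Qe0 => //; rewrite mem_enum.
Qed.

(** For b nonzero, whether a + e b >= 0 for infinitesimal e > 0. *)
Definition lex_ge0 (b a : R) := if 0 < b then 0 <= a else 0 < a.

Lemma lex_ge0_small (b a : R) : b != 0 -> exists2 e0, 0 < e0 &
  forall e, 0 < e -> e <= e0 -> a + e * b != 0 /\ (0 <= a + e * b) = lex_ge0 b a.
Proof.
move=> b_neq0; have nb_gt0 : 0 < `|b| by rewrite normr_gt0.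
exists (if a == 0 then 1 else `|a| / (2 * `|b|)).
  by case: eqVneq => // a_neq0; rewrite divr_gt0 ?mulr_gt0 ?normr_gt0.
move=> e e_gt0; rewrite /lex_ge0; have [->|a_neq0] := eqVneq a 0 => [_|].
  rewrite add0r (pmulr_rge0 _ e_gt0) lexx ltxx; split.
    by rewrite mulf_neq0 // gt_eqF.
  by case: ltgtP b_neq0.
rewrite ler_pdivlMr ?mulr_gt0 // => e_le.
have na_gt0 : 0 < `|a| by rewrite normr_gt0.
have eb_lt : `|e * b| < `|a| by rewrite normrM (gtr0_norm e_gt0); lra.
have : (if 0 < b then 0 <= a else 0 < a) = (0 < a).
  by case: ifP => // _; rewrite le_eqVlt eq_sym (negPf a_neq0).
move=> ->; move: eb_lt; rewrite ltr_norml; have [a_gt0|a_lt0|a0] := ltgtP 0 a.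
- rewrite (gtr0_norm a_gt0) => /andP[lo _].
  have H : 0 < a + e * b by lra.
  by rewrite gt_eqF // ltW.
- rewrite (ltr0_norm a_lt0) => /andP[_ hi].
  have H : a + e * b < 0 by lra.
  by rewrite lt_eqF // leNgt H.
- by rewrite -a0 eqxx in a_neq0.
Qed.

End GenericChoice.

Section Decomposition.
Variables (R : realFieldType) (r d : nat) (V : 'M[R]_(r, d)).
Implicit Types (B : {set 'I_r}) (x b : 'rV[R]_d).

Local Notation chart := (chart V).
Local Notation is_basis := (is_basis V).
Local Notation generated := (generated V).

Lemma coef_sum_monomials (P : pred 'I_r) (c : 'I_r -> R) (k : 'I_r) :
  P k -> (\sum_(l | P l) c l *: 'X^l)`_k = c k.
Proof.
move=> Pk; rewrite coef_sum (bigD1 k) //= coefZ coefXn eqxx mulr1 big1 ?addr0 //.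
move=> l /andP[_ lk]; rewrite coefZ coefXn [(k == l :> nat)]eq_sym.
by rewrite val_eqE (negPf lk) mulr0.
Qed.

Lemma horner_sum_monomials (P : pred 'I_r) (c : 'I_r -> R) t :
  (\sum_(l | P l) c l *: 'X^l).[t] = \sum_(l | P l) c l * t ^+ l.
Proof. by rewrite horner_sum; apply: eq_bigr => l _; rewrite hornerZ hornerXn. Qed.

(** Heights are 0 on the given basis B0, which makes it a regular cell, and t^j
    for j outside B0. The slack of k with respect to B is then a polynomial in
    t. If k lies outside B it is nonzero: for k outside B0 it has the term t^k;
    for k in B0 its vanishing would put v_k in the span of generators of B0
    other than v_k. *)
Lemma exists_generic_heights B0 : is_basis B0 ->
  exists2 h, generic_heights V h & regular_cell V h B0.
Proof.
move=> hB0.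
pose c (Bk : {set 'I_r} * 'I_r) (l : 'I_r) : R :=
  (Bk.2 == l)%:R - (V *m chart Bk.1) Bk.2 l.
pose p Bk : {poly R} := \sum_(l | l \notin B0) c Bk l *: 'X^l.
have p_neq0 Bk : is_basis Bk.1 && (Bk.2 \notin Bk.1) -> p Bk != 0.
  case: Bk => B k /= /andP[hB kB]; apply/negP => /eqP p0.
  have c0 l : l \notin B0 -> c (B, k) l = 0.
    move=> lB0.
    have <- := coef_sum_monomials (P := fun l => l \notin B0) (c (B, k)) lB0.
    by rewrite -/(p (B, k)) p0 coef0.
  have VCkk : (V *m chart B) k k = 0 by exact: coord_out.
  have [kB0|kB0] := boolP (k \in B0); last first.
    by have /eqP := c0 k kB0; rewrite /c /= eqxx VCkk subr0 oner_eq0.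
  have : (V *m chart B *m (V *m chart B0)) k k = 1.
    by rewrite mulmxA -[V *m _ *m V]mulmxA chartK // mulmx1 chart_gen // eqxx.
  rewrite mxE big1 => [/eqP|l _]; first by rewrite eq_sym oner_eq0.
  have [lB0|lB0] := boolP (l \in B0).
    rewrite (@chart_gen _ _ _ _ B0) //.
    have [->|_] := eqVneq l k; last by rewrite mulr0.
    by rewrite VCkk mul0r.
  have -> : (V *m chart B) k l = (k == l)%:R.
    by apply/eqP; rewrite eq_sym -subr_eq0; apply/eqP/(c0 l).
  have /negPf-> : k != l by apply: contraNneq lB0 => <-.
  by rewrite mul0r.
have [t t_gt0 pt] := exists_common_nonroot p_neq0.
pose h : 'cV[R]_r := \col_j (if j \in B0 then 0 else t ^+ j).
have slackE B k : slack V h B k 0 = (p (B, k)).[t].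
  have -> : slack V h B = (1%:M - V *m chart B) *m h by rewrite mulmxBl mul1mx.
  rewrite horner_sum_monomials mxE [RHS]big_mkcond /=; apply: eq_bigr => l _.
  rewrite [h l 0]mxE [X in X * _]mxE [X in (X + _) * _]mxE [X in (_ + X) * _]mxE.
  by case: ifP; rewrite ?mulr0.
exists h => [B k hB /eqP|].
  rewrite slackE; apply: contraTT => kB.
  by apply: (pt (B, k)); rewrite /= hB.
rewrite /regular_cell hB0; apply/forallP => k.
rewrite slackE horner_sum_monomials sumr_ge0 // => l lB0.
apply: mulr_ge0; last by rewrite exprn_ge0 // ltW.
by rewrite /c /= coord_out // subr0 ler0n.
Qed.

(** With weights t^i the coordinate of the point on generator j of a basis is a
    polynomial in t whose coefficient at t^j is 1. *)
Lemma exists_generic_point : exists2 tau : 'rV[R]_r,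
  forall j, 0 < tau 0 j & generic_point V (tau *m V).
Proof.
pose p (Bj : {set 'I_r} * 'I_r) : {poly R} :=
  \sum_l (V *m chart Bj.1) l Bj.2 *: 'X^l.
have p_neq0 Bj : is_basis Bj.1 && (Bj.2 \in Bj.1) -> p Bj != 0.
  case: Bj => B j /= /andP[hB jB]; apply/negP => /eqP p0.
  have := coef_sum_monomials (P := xpredT) (fun l => (V *m chart B) l j) (k := j) isT.
  rewrite -/(p (B, j)) p0 coef0 chart_gen // eqxx => /eqP.
  by rewrite eq_sym oner_eq0.
have [t t_gt0 pt] := exists_common_nonroot p_neq0.
exists (\row_j t ^+ j) => [j|B j hB jB]; first by rewrite mxE exprn_gt0.
rewrite -mulmxA mxE; under eq_bigr do rewrite mxE mulrC.
by rewrite -horner_sum_monomials; apply: (pt (B, j)); rewrite /= hB.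
Qed.

(** The simplicial cone on B without the facets through which a small shift
    by b leaves it. *)
Definition half_open_cell b B x :=
  [forall j in B, lex_ge0 ((b *m chart B) 0 j) ((x *m chart B) 0 j)].

(** The same cone without the complementary facets, those through which a small
    shift by -b leaves it. *)
Definition opposite_cell b B x :=
  [forall j in B, ~~ lex_ge0 ((b *m chart B) 0 j) (- (x *m chart B) 0 j)].

Lemma in_cellE B x : is_basis B ->
  in_cell V B x = [forall j in B, 0 <= (x *m chart B) 0 j].
Proof.
move=> hB; apply/forallP/forall_inP => [xB j _|xB j]; first exact: xB.
by have [/xB|jB] := boolP (j \in B); rewrite // coord_out.
Qed.

Lemma shifted_coord_sign b x : generic_point V b -> exists2 e0, 0 < e0 &
  forall e, 0 < e -> e <= e0 -> forall B j, is_basis B -> j \in B ->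
  let xj := ((x + e *: b) *m chart B) 0 j in
  xj != 0 /\ (0 <= xj) = lex_ge0 ((b *m chart B) 0 j) ((x *m chart B) 0 j).
Proof.
move=> gen_b.
pose Q (Bj : {set 'I_r} * 'I_r) e := is_basis Bj.1 -> Bj.2 \in Bj.1 ->
  let xj := ((x + e *: b) *m chart Bj.1) 0 Bj.2 in
  xj != 0 /\ (0 <= xj) =
    lex_ge0 ((b *m chart Bj.1) 0 Bj.2) ((x *m chart Bj.1) 0 Bj.2).
have Qsmall Bj : exists2 e0, 0 < e0 & forall e, 0 < e -> e <= e0 -> Q Bj e.
  case: Bj => B j; rewrite /Q /=.
  have [/andP[hB jB]|nh] := boolP (is_basis B && (j \in B)); last first.
    by exists 1 => // e _ _ hB jB; rewrite hB jB in nh.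
  have [e0 e0_gt0 H] := lex_ge0_small ((x *m chart B) 0 j) (gen_b B j hB jB).
  exists e0 => // e e_gt0 ee0 _ _.
  by rewrite mulmxDl -scalemxAl mxE [X in _ + X]mxE; exact: H.
have [e0 e0_gt0 H] := exists_common_small Qsmall.
by exists e0 => // e e_gt0 ee0 B j; apply: (H e e_gt0 ee0 (B, j)).
Qed.

(** For b interior to the cone, this characterizes the interior points x. *)
Definition strictly_above b x := exists2 e, 0 < e & generated (x - e *: b).

Lemma generatedD x y : generated x -> generated y -> generated (x + y).
Proof.
move=> [mu mu_ge0 ->] [nu nu_ge0 ->]; exists (mu + nu); last by rewrite mulmxDl.
by move=> j; rewrite mxE addr_ge0.
Qed.

Lemma generatedZ x a : 0 <= a -> generated x -> generated (a *: x).
Proof.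
move=> a_ge0 [mu mu_ge0 ->]; exists (a *: mu); last by rewrite scalemxAl.
by move=> j; rewrite mxE mulr_ge0.
Qed.

(** Shift x to x + e b or x - e b for a small e > 0. The shifted point is in
    general position, so it lies in exactly one regular cell as soon as it lies
    in the cone; membership in each cell is dictated by the lexicographic signs
    that define the half-open cells, which no longer mention e. A nonnegative
    lexicographic sign forces a nonnegative coordinate, so x + e b lies in the
    cone only if x does. *)
Lemma half_open_decomposition : row_full V ->
  exists2 tau : 'rV[R]_r, forall j, 0 < tau 0 j &
  exists2 cells : {set {set 'I_r}}, forall B, B \in cells -> is_basis B &
  forall x,
    (\sum_(B in cells) half_open_cell (tau *m V) B x)%N = `[< generated x >]
    /\ (\sum_(B in cells) opposite_cell (tau *m V) B x)%N
      = `[< strictly_above (tau *m V) x >].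
Proof.
move=> fV; have [B0 hB0] := exists_basis fV.
have [h gen_h reg0] := exists_generic_heights hB0.
have [tau tau_gt0 gen_b] := exists_generic_point.
exists tau => //; exists [set B | regular_cell V h B]%SET.
  by move=> B; rewrite inE => /andP[].
set b := tau *m V in gen_b *.
have gb : generated b by exists tau => // j; rewrite ltW.
move=> x; split.
- have [e0 e0_gt0 H] := shifted_coord_sign x gen_b.
  have {}H := H e0 e0_gt0 (lexx _).
  have cellE B : is_basis B -> in_cell V B (x + e0 *: b) = half_open_cell b B x.
    by move=> hB; rewrite in_cellE //; apply: eq_forallb_in => j /(H B j hB)[].
  have gen_y : generic_point V (x + e0 *: b) by move=> B j hB /(H B j hB)[].
  have countE := cell_count gen_h reg0 gen_y.
  have -> : (\sum_(B in [set B | regular_cell V h B]%SET) half_open_cell b B x)%N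
      = `[< generated (x + e0 *: b) >].
    rewrite -countE; apply: eq_big => [B|B]; first by rewrite inE.
    by rewrite inE => /andP[hB _]; rewrite cellE.
  congr (nat_of_bool _); apply/asbool_equiv_eq; split=> [gy|gx]; last first.
    by apply: generatedD => //; apply: generatedZ => //; exact: ltW.
  have [B /andP[hB _] yB] := cell_exists gen_h reg0 gy.
  apply: (in_cell_generated hB); rewrite in_cellE //.
  rewrite cellE // in yB; apply/forall_inP => j jB.
  move/forall_inP: yB => /(_ j jB); rewrite /lex_ge0; case: ifP => // _.
  exact: ltW.
- have [e1 e1_gt0 H] := shifted_coord_sign (- x) gen_b.
  have coordE e : 0 < e -> e <= e1 -> forall B j, is_basis B -> j \in B ->
    let yj := ((x - e *: b) *m chart B) 0 j in
    yj != 0 /\ (0 <= yj) =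
      ~~ lex_ge0 ((b *m chart B) 0 j) (- (x *m chart B) 0 j).
    move=> e_gt0 ee1 B j hB jB /=; have [] := H e e_gt0 ee1 B j hB jB.
    have -> : - x + e *: b = - (x - e *: b) by rewrite opprB addrC.
    rewrite !mulNmx mxE [(- (x *m _)) 0 j]mxE oppr_eq0 => y_neq0 <-.
    by split=> //; rewrite oppr_ge0 -ltNge le_eqVlt eq_sym (negPf y_neq0).
  have countE e : 0 < e -> e <= e1 ->
      (\sum_(B in [set B | regular_cell V h B]%SET) opposite_cell b B x)%N
      = `[< generated (x - e *: b) >].
    move=> e_gt0 ee1; have {}H := coordE e e_gt0 ee1.
    have gen_y : generic_point V (x - e *: b) by move=> B j hB /(H B j hB)[].
    rewrite -(cell_count gen_h reg0 gen_y).
    apply: eq_big => [B|B]; first by rewrite inE.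
    rewrite inE => /andP[hB _]; congr (nat_of_bool _).
    by rewrite in_cellE //; apply/esym/eq_forallb_in => j /(H B j hB)[].
  rewrite (countE e1) //; congr (nat_of_bool _); apply/asbool_equiv_eq.
  split=> [gy|[e2 e2_gt0 gy]]; first by exists e1.
  (* The witness e2 may be too large to read off the cells; any smaller
     positive value is a witness too. *)
  pose e := Num.min e1 e2; have e_gt0 : 0 < e by rewrite lt_min e1_gt0.
  have gy' : generated (x - e *: b).
    have -> : x - e *: b = (x - e2 *: b) + (e2 - e) *: b.
      by rewrite scalerBl addrA subrK.
    apply: generatedD => //; apply: generatedZ => //.
    by rewrite subr_ge0 ge_min lexx orbT.
  have e_le : e <= e1 by rewrite ge_min lexx.
  apply/asboolP.
  move: (countE e e_gt0 e_le) (countE e1 e1_gt0 (lexx _)) => -> /eqP.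
  by rewrite (asboolT gy'); case: asbool.
Qed.

End Decomposition.

(** * Representing series by rational functions *)

Section Fractions.
Variable A : idomainType.
Local Notation "x %:F" := (FracField.tofrac x).

(** Relates the chosen representative of a fraction, in terms of which
    inversion of the variables is defined, to field operations. *)
Lemma fraction_repr (f : {fraction A}) :
  f = (frac (repr f)).1%:F / (frac (repr f)).2%:F.
Proof.
set n := (frac _).1; set d := (frac _).2.
have d_neq0 : d != 0 by exact: denom_ratioP.
suff fd : f * d%:F = n%:F.
  by rewrite -fd mulfK // tofrac_eq0.
rewrite -[f in LHS]reprK; unlock FracField.tofrac.
rewrite -[LHS]FracField.pi_mul; apply/eqmodP.
rewrite /= FracField.equivfE /FracField.mulf !numden_Ratio ?mulf_neq0 ?oner_neq0 //.
by rewrite !mulr1 mulrC.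
Qed.

End Fractions.

Section LaurentSeries.
Variable m : nat.

Local Notation mpolQ := (mpoly m rat).
Local Notation "x %:F" := (FracField.tofrac x).
Local Notation "'X_[ d ]" := (@mpolyX m rat d) (at level 8).
Implicit Types (p q D N : mpolQ) (c : fseries m) (z a : 'rV[int]_m).
Implicit Types (d e : multinom m) (f g : ratfun m).

(** The linear form on polynomials with value u d at the monomial of exponent d.
    Both the action of polynomials on series and the passage from polynomials
    to series are of this kind, so linearity is proved once. *)
Definition pairing (u : multinom m -> rat) p : rat :=
  \sum_(d <- msupp p) mcoeff d p * u d.

(** A range of summation that does not depend on p is what makes additivity
    in p visible. *)
Lemma pairing_bounded u p k : (msize p <= k)%N ->
  pairing u p = \sum_(d : bmultinom m k) mcoeff d p * u d.
Proof.
move=> le_pk; set I : subFinType _ := bmultinom m k.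
rewrite /pairing (ssrcomplements.big_mksub I) ?msupp_uniq //=; last first.
  by move=> d /msize_mdeg_lt /leq_trans; apply.
by rewrite big_rmcond //= => d /memN_msupp_eq0 ->; rewrite mul0r.
Qed.

Lemma pairing0 u : pairing u 0 = 0.
Proof. by rewrite /pairing msupp0 big_nil. Qed.

Lemma pairingX u d : pairing u 'X_[d] = u d.
Proof. by rewrite /pairing msuppX big_seq1 mcoeffX eqxx mul1r. Qed.

Lemma pairingP u x p q : pairing u (x *: p + q) = x * pairing u p + pairing u q.
Proof.
pose k := maxn (msize (x *: p + q)) (maxn (msize p) (msize q)).
rewrite !(@pairing_bounded u _ k) ?leq_max ?leqnn ?orbT // mulr_sumr -big_split.
by apply: eq_bigr => d _; rewrite mcoeffD mcoeffZ mulrDl mulrA.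
Qed.

Lemma mul_fseriesX d c z : mul_fseries 'X_[d] c z = c (z - mexp d).
Proof. exact: (pairingX (fun d => c (z - mexp d))). Qed.

Lemma mul_fseriesDl p q c z :
  mul_fseries (p + q) c z = mul_fseries p c z + mul_fseries q c z.
Proof.
have := pairingP (fun d => c (z - mexp d)) 1 p q.
by rewrite scale1r mul1r.
Qed.

Lemma mul_fseriesDr p c c' z : mul_fseries p (fun y => c y + c' y) z =
  mul_fseries p c z + mul_fseries p c' z.
Proof. by rewrite -big_split; apply: eq_bigr => d _; rewrite mulrDr. Qed.

Lemma mexpD d e : mexp (mnm_add d e) = mexp d + mexp e.
Proof. by apply/rowP => i; rewrite !mxE mnmDE PoszD. Qed.

Lemma mexp_inj : injective (@mexp m).
Proof. by move=> d e /rowP de; apply/mnmP => i; have := de i; rewrite !mxE => -[]. Qed.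

Lemma mul_fseriesM p q c z :
  mul_fseries (p * q) c z = mul_fseries p (mul_fseries q c) z.
Proof.
have mulX d q' y : mul_fseries ('X_[d] * q') c y = mul_fseries q' c (y - mexp d).
  elim/mpolyind: q' => [|x e q' _ _ IH].
    by rewrite mulr0 /mul_fseries msupp0 !big_nil.
  rewrite mulrDr -scalerAr -mpolyXD.
  rewrite [LHS](pairingP (fun e => c (y - mexp e))).
  rewrite [RHS](pairingP (fun e => c (y - mexp d - mexp e))) !pairingX.
  by rewrite mexpD opprD addrA; congr (_ + _).
elim/mpolyind: p => [|x d p _ _ IH].
  by rewrite mul0r /mul_fseries msupp0 !big_nil.
rewrite mulrDl -scalerAl [LHS](pairingP (fun e => c (z - mexp e))).
rewrite [RHS](pairingP (fun e => mul_fseries q c (z - mexp e))) pairingX -mulX.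
by congr (_ + _).
Qed.

Definition unit_fseries a : fseries m := fun z => (z == a)%:R.

(** The series of a polynomial is its action on the series 1; associativity of
    the action then covers products with polynomial series too. *)
Lemma fseries_of_mpolyE p z :
  fseries_of_mpoly p z = mul_fseries p (unit_fseries 0) z.
Proof.
rewrite /fseries_of_mpoly /mul_fseries big_mkcond; apply: eq_bigr => d _.
by rewrite /unit_fseries subr_eq0 [z == _]eq_sym; case: eqP; rewrite ?mulr1 ?mulr0.
Qed.

Lemma fseries_of_mpoly_coef p d : fseries_of_mpoly p (mexp d) = mcoeff d p.
Proof.
rewrite fseries_of_mpolyE; pose u e : rat := (unit_fseries 0 (mexp d - mexp e)).
rewrite -[LHS]/(pairing u p); elim/mpolyind: p => [|x e p _ _ IH].
  by rewrite pairing0 mcoeff0.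
rewrite pairingP IH pairingX mcoeffD mcoeffZ mcoeffX /u /unit_fseries subr_eq0.
by rewrite (inj_eq mexp_inj) [d == e]eq_sym.
Qed.

Lemma representsP c f : represents c f <-> exists N D,
  [/\ D != 0, f = N%:F / D%:F
    & forall z, mul_fseries D c z = mul_fseries N (unit_fseries 0) z].
Proof.
split=> -[N [D [D0 fE cE]]]; exists N, D; split=> //.
  by move=> z; rewrite cE fseries_of_mpolyE.
by apply/funext => z; rewrite cE fseries_of_mpolyE.
Qed.

(** D c = N and D' c = N' give D' N = D' D c = D N'. *)
Lemma represents_uniq c f g : represents c f -> represents c g -> f = g.
Proof.
move=> /representsP[N [D [D0 -> cE]]] /representsP[N' [D' [D'0 -> c'E]]].
apply/eqP; rewrite eqr_div ?tofrac_eq0 // -!rmorphM tofrac_eq; apply/eqP/mpolyP => d.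
rewrite -!fseries_of_mpoly_coef !fseries_of_mpolyE mulrC [in RHS]mulrC.
rewrite [LHS]mul_fseriesM [RHS]mul_fseriesM.
rewrite -(funext cE) -(funext c'E) -!mul_fseriesM.
by rewrite mulrC.
Qed.

Lemma represents0 : represents (fun _ => 0 : rat) (0 : ratfun m).
Proof.
apply/representsP; exists 0, 1; rewrite oner_neq0 rmorph0 mul0r; split=> // z.
rewrite {2}/mul_fseries msupp0 big_nil /mul_fseries big1 // => d _.
by rewrite mulr0.
Qed.

Lemma represents_unit0 : represents (unit_fseries 0) 1.
Proof. by apply/representsP; exists 1, 1; rewrite oner_neq0 rmorph1 divr1. Qed.

Lemma representsD c c' f f' : represents c f -> represents c' f' ->
  represents (fun z => c z + c' z) (f + f').
Proof.
move=> /representsP[N [D [D0 -> cE]]] /representsP[N' [D' [D'0 -> c'E]]].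
apply/representsP; exists (N * D' + N' * D), (D * D'); split=> [||z].
- by rewrite mulf_neq0.
- by rewrite addf_div ?tofrac_eq0 // !rmorphM rmorphD !rmorphM.
- rewrite mul_fseriesDr mul_fseriesDl; congr (_ + _).
    by rewrite [D * D']mulrC [N * D']mulrC !mul_fseriesM (funext cE).
  by rewrite [N' * D]mulrC !mul_fseriesM (funext c'E).
Qed.

(** The way every rational function below is found: a linear equation p c = q c'
    between series is solved for c. *)
Lemma represents_ratio p q c c' f : p != 0 ->
  (forall z, mul_fseries p c z = mul_fseries q c' z) ->
  represents c' f -> represents c (q%:F / p%:F * f).
Proof.
move=> p0 pcE /representsP[N [D [D0 -> cE]]].
apply/representsP; exists (q * N), (D * p); split=> [||z].
- by rewrite mulf_neq0.
- by rewrite !rmorphM mulf_div [p%:F * _]mulrC.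
- by rewrite mul_fseriesM (funext pcE) -mul_fseriesM mulrC !mul_fseriesM (funext cE).
Qed.

Lemma mpolyX_neq0 d : 'X_[d] != 0.
Proof.
apply/eqP => /(congr1 (mcoeff d)).
by rewrite mcoeffX eqxx mcoeff0 => /eqP; rewrite oner_eq0.
Qed.

Lemma tofracX_neq0 d : 'X_[d]%:F != 0.
Proof. by rewrite tofrac_eq0 mpolyX_neq0. Qed.

(** The Laurent monomial y^a. *)
Definition monomial a : ratfun m := \prod_i 'X_[mnm1 i]%:F ^ a 0 i.

Lemma monomialD a a' : monomial (a + a') = monomial a * monomial a'.
Proof.
rewrite /monomial -big_split; apply: eq_bigr => i _.
by rewrite mxE expfzDr // tofracX_neq0.
Qed.

Lemma monomial0 : monomial 0 = 1.
Proof. by rewrite /monomial big1 // => i _; rewrite mxE expr0z. Qed.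

Lemma monomial_neq0 a : monomial a != 0.
Proof. by apply/prodf_neq0 => i _; rewrite expfz_neq0 // tofracX_neq0. Qed.

Lemma monomialN a : monomial (- a) = (monomial a)^-1.
Proof.
apply: (mulIf (monomial_neq0 a)); rewrite -monomialD addNr monomial0 mulVf //.
exact: monomial_neq0.
Qed.

Lemma mpolyX_prod d : 'X_[d] = \prod_i 'X_[mnm1 i] ^+ d i.
Proof. by rewrite (mpolyXE_id rat d). Qed.

Lemma monomial_mexp d : monomial (mexp d) = 'X_[d]%:F.
Proof.
rewrite mpolyX_prod rmorph_prod /monomial; apply: eq_bigr => i _.
by rewrite mxE -exprnP rmorphXn.
Qed.

(** Writing a as the difference of two exponents of polynomial monomials turns
    Laurent identities into polynomial ones. *)
Definition pos_part a : multinom m :=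
  Multinom [tuple if (0 <= a ord0 i)%R then absz (a ord0 i) else 0%N | i < m].

Lemma mexp_pos_part a : mexp (pos_part a) - mexp (pos_part (- a)) = a.
Proof.
apply/rowP => i; rewrite !mxE !mnmE mxE oppr_ge0 abszN.
case: (ltgtP (a 0 i) 0) => [lt|gt|->]; rewrite ?subr0 ?abszE.
- by rewrite ltr0_norm // sub0r opprK.
- by rewrite gtr0_norm.
- by rewrite normr0.
Qed.

Lemma sub_pos_part a z :
  z - mexp (pos_part a) = z - mexp (pos_part (- a)) - a.
Proof. by rewrite -addrA -opprD -{3}[a]mexp_pos_part subrKC. Qed.

Lemma mul_fseries_pos c a z :
  mul_fseries 'X_[pos_part a] c z =
  mul_fseries 'X_[pos_part (- a)] (fun y => c (y - a)) z.
Proof.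
by rewrite !mul_fseriesX (sub_pos_part a).
Qed.

Lemma monomial_parts a :
  monomial a = 'X_[pos_part a]%:F / 'X_[pos_part (- a)]%:F.
Proof. by rewrite -{1}[a]mexp_pos_part monomialD monomialN !monomial_mexp. Qed.

Lemma represents_unit a : represents (unit_fseries a) (monomial a).
Proof.
rewrite monomial_parts -[_ / _]mulr1.
apply: (represents_ratio _ _ represents_unit0).
  exact: mpolyX_neq0.
move=> z; rewrite (mul_fseries_pos (unit_fseries 0)) !mul_fseriesX.
by rewrite /unit_fseries subr_eq0.
Qed.

(** * Inverting the variables *)

Lemma mpoly_inv_varsP : exists phi : {rmorphism mpolQ -> ratfun m},
  mpoly_inv_vars (m := m) =1 phi.
Proof.
pose cst : {rmorphism rat -> ratfun m} :=
  (@FracField.tofrac mpolQ \o @mpolyC m rat).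
by exists (mmap cst (fun i => 'X_[mnm1 i]%:F^-1)).
Qed.

Lemma mpoly_inv_varsX d : mpoly_inv_vars 'X_[d] = monomial (- mexp d).
Proof.
rewrite /mpoly_inv_vars /mmap msuppX big_seq1 mcoeffX eqxx rmorph1 mul1r /mmap1.
rewrite monomialN /monomial -prodfV; apply: eq_bigr => i _.
by rewrite mxE -exprnP exprVn.
Qed.

(** Multiplying p(1/y) by a monomial of large exponent g clears the
    denominators and reverses the coefficients of p, so that no two of them
    merge. *)
Lemma mpoly_inv_vars_neq0 p : p != 0 -> mpoly_inv_vars p != 0.
Proof.
move=> p_neq0.
(* The size of p exceeds the degree of p in each variable. *)
pose g : multinom m := Multinom [tuple msize p | i < m].
have le_g d i : d \in msupp p -> (d i <= g i)%N.
  move=> /msize_mdeg_lt lt_d; rewrite mnmE; apply: leq_trans (ltnW lt_d).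
  by rewrite mdegE (bigD1 i) //= leq_addr.
pose q : mpolQ := \sum_(d <- msupp p) mcoeff d p *: 'X_[mnm_sub g d].
have qE : mpoly_inv_vars p * 'X_[g]%:F = q%:F.
  rewrite /mpoly_inv_vars /mmap mulr_suml rmorph_sum; apply: eq_big_seq => d dp.
  rewrite -mul_mpolyC rmorphM -mulrA; congr (_ * _).
  have -> : mmap1 (fun i => 'X_[mnm1 i]%:F^-1) d = monomial (- mexp d).
    rewrite monomialN /monomial -prodfV; apply: eq_bigr => i _.
    by rewrite mxE -exprnP exprVn.
  rewrite -[RHS]/('X_[mnm_sub g d]%:F) -!monomial_mexp -monomialD.
  congr (monomial _); apply/rowP => i.
  rewrite !mxE mnmBE addrC subzn //; exact: le_g.
suff q_neq0 : q != 0.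
  by apply: contra_neq q_neq0 => p0; apply/eqP; rewrite -tofrac_eq0 -qE p0 mul0r.
case: (msupp p =P [::]) => [/msuppnil0 p0|]; first by rewrite p0 eqxx in p_neq0.
case E : (msupp p) => [//|d0 s] _.
have d0p : d0 \in msupp p by rewrite E mem_head.
apply/eqP => /(congr1 (mcoeff (mnm_sub g d0))) /eqP.
rewrite mcoeff0 raddf_sum (bigD1_seq d0) ?msupp_uniq //= mcoeffZ mcoeffX.
rewrite eqxx mulr1 big_seq_cond big1.
  by rewrite addr0; apply/negP; rewrite -mcoeff_msupp.
move=> d /andP[dp /negPf dd0]; rewrite mcoeffZ mcoeffX.
case: eqP => [/mnmP gd|]; last by rewrite mulr0.
case/negP: (negbT dd0); apply/eqP/mnmP => i; have := gd i; rewrite !mnmBE.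
by move=> /(congr1 (subn (g i))); rewrite !subKn // le_g.
Qed.

(** Makes the definition through a chosen representative usable: since p(1/y)
    is nonzero for nonzero p, any fraction may be used instead. *)
Lemma inv_vars_frac N D : D != 0 ->
  inv_vars (N%:F / D%:F) = mpoly_inv_vars N / mpoly_inv_vars D.
Proof.
move=> D0; rewrite /inv_vars; set f := N%:F / D%:F.
set n := (frac _).1; set d := (frac _).2.
have d0 : d != 0 by exact: denom_ratioP.
have [phi phiE] := mpoly_inv_varsP.
apply/eqP; rewrite eqr_div ?mpoly_inv_vars_neq0 // !phiE -!rmorphM.
suff -> : n * D = N * d by [].
have fE : f = n%:F / d%:F := fraction_repr f.
by apply/eqP; rewrite -tofrac_eq !tofracM -eqr_div ?tofrac_eq0 // -fE.
Qed.

Lemma fractionP f : exists N D, D != 0 /\ f = N%:F / D%:F.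
Proof.
exists (frac (repr f)).1, (frac (repr f)).2.
by split; [exact: denom_ratioP | exact: fraction_repr].
Qed.

Lemma inv_varsD f g : inv_vars (f + g) = inv_vars f + inv_vars g.
Proof.
have [N [D [D0 ->]]] := fractionP f; have [N' [D' [D'0 ->]]] := fractionP g.
have [phi phiE] := mpoly_inv_varsP.
rewrite addf_div ?tofrac_eq0 // -!rmorphM -rmorphD !inv_vars_frac ?mulf_neq0 //.
by rewrite addf_div ?mpoly_inv_vars_neq0 // !phiE rmorphD !rmorphM.
Qed.

Lemma inv_varsM f g : inv_vars (f * g) = inv_vars f * inv_vars g.
Proof.
have [N [D [D0 ->]]] := fractionP f; have [N' [D' [D'0 ->]]] := fractionP g.
have [phi phiE] := mpoly_inv_varsP.
rewrite mulf_div -!rmorphM !inv_vars_frac ?mulf_neq0 //.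
by rewrite mulf_div !phiE !rmorphM.
Qed.

Lemma inv_vars0 : inv_vars (0 : ratfun m) = 0.
Proof. by apply: (addrI (inv_vars 0)); rewrite -inv_varsD !addr0. Qed.

Lemma inv_varsN f : inv_vars (- f) = - inv_vars f.
Proof. by apply/eqP; rewrite -addr_eq0 -inv_varsD addNr inv_vars0. Qed.

Lemma inv_vars_monomial a : inv_vars (monomial a) = monomial (- a).
Proof.
rewrite [in LHS]monomial_parts (inv_vars_frac _ (mpolyX_neq0 _)).
rewrite !mpoly_inv_varsX -monomialN -monomialD; congr (monomial _).
by rewrite opprK -{3}[a]mexp_pos_part opprB addrC.
Qed.

Lemma inv_vars1 : inv_vars (1 : ratfun m) = 1.
Proof. by rewrite -[1 in LHS]monomial0 inv_vars_monomial oppr0 monomial0. Qed.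

Lemma inv_varsV f : inv_vars f^-1 = (inv_vars f)^-1.
Proof.
have [->|f0] := eqVneq f 0; first by rewrite invr0 inv_vars0 invr0.
have inv1 : inv_vars f * inv_vars f^-1 = 1.
  by rewrite -inv_varsM divff // inv_vars1.
have fi0 : inv_vars f != 0.
  by apply: contra_eq_neq inv1 => ->; rewrite mul0r eq_sym oner_neq0.
by apply: (mulfI fi0); rewrite inv1 divff.
Qed.

(** * Reciprocal pairs of series *)

(** The conclusion of the reciprocity theorem as a relation between series.
    Being additive, it may be checked on the pieces of a decomposition. *)
Definition reciprocal k c c' := exists2 f, represents c f &
  represents c' ((-1) ^+ k * inv_vars f).

Lemma reciprocal_ext k c1 c2 c1' c2' : c1 =1 c2 -> c1' =1 c2' ->
  reciprocal k c1 c1' -> reciprocal k c2 c2'.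
Proof. by move=> /funext-> /funext->. Qed.

Lemma reciprocal0 k : reciprocal k (fun=> 0) (fun=> 0).
Proof. by exists 0; rewrite ?inv_vars0 ?mulr0; exact: represents0. Qed.

Lemma reciprocalD k c1 c2 c1' c2' : reciprocal k c1 c1' -> reciprocal k c2 c2' ->
  reciprocal k (fun z => c1 z + c2 z) (fun z => c1' z + c2' z).
Proof.
move=> [f cf c'f] [g cg c'g]; exists (f + g); first exact: representsD.
by rewrite inv_varsD mulrDr; exact: representsD.
Qed.

Lemma reciprocal_sum (I : eqType) (s : seq I) (c c' : I -> fseries m) k :
  (forall i, i \in s -> reciprocal k (c i) (c' i)) ->
  reciprocal k (fun z => \sum_(i <- s) c i z) (fun z => \sum_(i <- s) c' i z).
Proof.
elim: s => [_|i s IH H].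
  by apply: reciprocal_ext (reciprocal0 k) => z; rewrite big_nil.
apply: reciprocal_ext (reciprocalD (H i (mem_head _ _)) (IH _)) => [z|z|j js].
- by rewrite big_cons.
- by rewrite big_cons.
- by apply: H; rewrite inE js orbT.
Qed.

(** For Laurent polynomials, inverting the variables negates the exponents. *)
Lemma reciprocal_finite (s : seq 'rV[int]_m) : uniq s ->
  reciprocal 0 (fun z => (z \in s)%:R) (fun z => (- z \in s)%:R).
Proof.
move=> uniq_s.
have memE z : (z \in s)%:R = \sum_(a <- s) unit_fseries a z :> rat.
  have [zs|zs] := boolP (z \in s).
    rewrite (bigD1_seq z) //= /unit_fseries eqxx big1 ?addr0 // => a.
    by rewrite eq_sym => /negPf->.
  rewrite big_seq big1 // => a as_; rewrite /unit_fseries.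
  by case: eqP zs => // ->; rewrite as_.
apply: (reciprocal_ext (c1 := fun z => \sum_(a <- s) unit_fseries a z)
  (c1' := fun z => \sum_(a <- s) unit_fseries (- a) z)) => [z|z|].
- by rewrite memE.
- by rewrite memE; apply: eq_bigr => a _; rewrite /unit_fseries eqr_oppLR.
apply: reciprocal_sum => a _; exists (monomial a); first exact: represents_unit.
by rewrite mul1r inv_vars_monomial; exact: represents_unit.
Qed.

(** The scalar identity behind the next lemma, with u / v for y^a. *)
Lemma reciprocal_scalar (F : fieldType) (u v e f : F) : u != 0 -> v - u != 0 ->
  -1 * e * ((1 - v / u)^-1 * f) = u / (v - u) * (e * f).
Proof.
move=> u0 vu0; have uv0 : u - v != 0 by rewrite -opprB oppr_eq0.
by field; rewrite u0 uv0 vu0.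
Qed.

(** If (1 - y^a) c represents f, then c represents f / (1 - y^a). Inverting the
    variables turns the factor into 1 / (1 - y^-a) = - y^a / (1 - y^a). So the
    series c' has to satisfy (y^-a - 1) c' = (the partner of (1 - y^a) c), and
    one sign is gained. *)
Lemma reciprocal_difference k a c c' : a != 0 ->
  reciprocal k (fun z => c z - c (z - a)) (fun z => c' (z + a) - c' z) ->
  reciprocal k.+1 c c'.
Proof.
move=> a0 [f cf c'f]; set u := 'X_[pos_part a]; set v := 'X_[pos_part (- a)].
have vu0 : v - u != 0.
  rewrite subr_eq0; apply: contra a0 => /eqP.
  move=> /(congr1 (mcoeff (pos_part a))) /eqP; rewrite !mcoeffX eqxx.
  have [E _|_] := eqVneq (pos_part (- a)) (pos_part a);
    last by rewrite eq_sym oner_eq0.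
  by rewrite -[a]mexp_pos_part E subrr.
have uvE : u%:F / v%:F = monomial a by rewrite monomial_parts.
have v0 : v%:F != 0 by exact: tofracX_neq0.
have u0 : u%:F != 0 by exact: tofracX_neq0.
have vuF0 : v%:F - u%:F != 0 by rewrite -tofracB tofrac_eq0.
have mulvu c1 z : mul_fseries (v - u) c1 z =
    c1 (z - mexp (pos_part (- a))) - c1 (z - mexp (pos_part a)).
  rewrite -scaleN1r addrC [LHS](pairingP (fun d => c1 (z - mexp d))) !pairingX.
  by rewrite mulN1r addrC.
exists (v%:F / (v - u)%:F * f).
  apply: (represents_ratio vu0 _ cf) => z.
  by rewrite mulvu mul_fseriesX (sub_pos_part a).
have -> : (-1) ^+ k.+1 * inv_vars (v%:F / (v - u)%:F * f) =
    u%:F / (v - u)%:F * ((-1) ^+ k * inv_vars f).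
  have -> : v%:F / (v - u)%:F = (1 - monomial a)^-1.
    by rewrite tofracB -uvE -[1](divff v0) -mulrBl invf_div.
  rewrite inv_varsM inv_varsV inv_varsD inv_varsN inv_vars_monomial.
  rewrite inv_vars1 monomialN -uvE invf_div tofracB exprS.
  move: (inv_vars f) ((-1) ^+ k : ratfun m) (u%:F) (v%:F) u0 vuF0.
  by move=> g e x y x0 yx0; exact: (reciprocal_scalar e g x0 yx0).
apply: (represents_ratio vu0 _ c'f) => z.
by rewrite mulvu mul_fseriesX (sub_pos_part a) !subrK.
Qed.

End LaurentSeries.

(** * Reciprocity for one half-open simplicial cone *)

(** Coordinates l_j on a set L of exponents, j in B, such that translation by
    a_j raises l_j by 1 and fixes the others. *)
Section SimplicialCones.
Variables (m : nat) (R : realFieldType) (I : finType) (B : {set I}).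
Variables (L : pred 'rV[int]_m) (l : I -> 'rV[int]_m -> R).
Variables (a : I -> 'rV[int]_m) (b : I -> R).
Hypothesis L_opp : forall z, L (- z) = L z.
Hypothesis L_sub : forall j z, L (z - a j) = L z.
Hypothesis l_opp : forall j z, l j (- z) = - l j z.
Hypothesis l_sub : forall j k z, j \in B -> k \in B ->
  l j (z - a k) = l j z - (j == k)%:R.
Hypothesis a_neq0 : forall j, j \in B -> a j != 0.
Variable box_points : seq 'rV[int]_m.
Hypothesis box_pointsP : forall z, L z ->
  (forall j, j \in B -> 0 <= l j z <= 1) -> z \in box_points.

(** The interval [0, 1) when c > 0, and (0, 1] otherwise. *)
Definition half_open_box (c x : R) := lex_ge0 c x && ~~ lex_ge0 c (x - 1).

Lemma lex_ge0_mono (c x : R) : lex_ge0 c (x - 1) -> lex_ge0 c x.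
Proof. by rewrite /lex_ge0; case: ifP => _ ?; lra. Qed.

Lemma lex_ge0_difference (c x : R) :
  (lex_ge0 c x)%:R - (lex_ge0 c (x - 1))%:R = (half_open_box c x)%:R :> rat.
Proof.
rewrite /half_open_box; have := @lex_ge0_mono c x.
by do 2!case: lex_ge0 => //=; rewrite ?subrr ?subr0 // => /(_ isT).
Qed.

Lemma half_open_box_bounds (c x : R) : half_open_box c x -> 0 <= x <= 1.
Proof.
by rewrite /half_open_box /lex_ge0; case: ifP => _; rewrite -?leNgt -?ltNge; lra.
Qed.

(** Coordinates outside J are already cut down to a half-open unit interval;
    J = B is the half-open cone, and J empty its fundamental parallelepiped. *)
Definition truncated (J : {set I}) z : rat :=
  (L z)%:R * \prod_(j in B)
    (if j \in J then lex_ge0 (b j) (l j z) else half_open_box (b j) (l j z))%:R.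

(** The opposite cone, cut down in the opposite direction: its coordinates
    outside J run over the negated interval. *)
Definition truncated_opp (J : {set I}) z : rat :=
  (L z)%:R * \prod_(j in B)
    (if j \in J then ~~ lex_ge0 (b j) (- l j z)
     else half_open_box (b j) (- l j z))%:R.

(** Indicators are written as products so that one coordinate can be factored
    out. *)
Lemma prod_bool (A : {set I}) (P : pred I) :
  \prod_(j in A) (P j)%:R = [forall j in A, P j]%:R :> rat.
Proof.
have [/forall_inP PA|/forall_inPn[j jA /negPf Pj]] := boolP [forall j in A, P j].
  by rewrite big1 // => j /PA->.
by rewrite (bigD1 j) //= Pj mul0r.
Qed.

(** Each coordinate in J contributes a factor 1 / (1 - y^a): subtracting its
    translate by a_j truncates the half-open cone to l_j in a half-open unit
    interval, and the difference in the opposite direction truncates the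
    opposite cone to the negated interval. Once all coordinates are truncated
    the two finite sums are exchanged by negation of the exponents. *)
Lemma reciprocal_truncated (J : {set I}) : J \subset B ->
  reciprocal #|J| (truncated J) (truncated_opp J).
Proof.
have [n] := ubnP #|J|; elim: n J => // n IH J.
have [->|[j jJ]] := set_0Vmem J => [_ _|ltJ JB].
  rewrite cards0.
  pose s := [seq z <- undup box_points | truncated finset.set0 z != 0].
  have uniq_s : uniq s by rewrite filter_uniq ?undup_uniq.
  have memE z : truncated finset.set0 z = (z \in s)%:R.
    rewrite /s mem_filter mem_undup.
    have TE : truncated finset.set0 z =
        (L z && [forall j in B, half_open_box (b j) (l j z)])%:R.
      rewrite /truncated -mulnb natrM -prod_bool; congr (_ * _).
      by apply: eq_bigr => j _; rewrite finset.in_set0.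
    rewrite TE pnatr_eq0 eqb0 negbK.
    have [/andP[Lz /forall_inP box]|//] := boolP (L z && _).
    by rewrite box_pointsP // => j jB; apply: half_open_box_bounds (box j jB).
  apply: reciprocal_ext (reciprocal_finite uniq_s) => z; first by rewrite memE.
  rewrite -memE /truncated /truncated_opp L_opp; congr (_ * _).
  by apply: eq_bigr => j _; rewrite finset.in_set0 l_opp.
have jB : j \in B by exact: (fintype.subsetP JB).
have shift_neq k z : k \in B -> k != j -> l k (z - a j) = l k z.
  by move=> kB /negPf kj; rewrite l_sub // kj subr0.
have JjB : J :\ j \subset B by rewrite (fintype.subset_trans (subD1set _ _)).
have lt_Jj : (#|J :\ j| < n)%N.
  by move: ltJ; rewrite [in X in X -> _](cardsD1 j) jJ.
rewrite (cardsD1 j) jJ add1n; apply: (reciprocal_difference (a := a j)) => //.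
  exact: a_neq0.
apply: reciprocal_ext (IH _ lt_Jj JjB) => z.
- rewrite /truncated L_sub -mulrBr (bigD1 j) //= [in RHS](bigD1 j) //=.
  rewrite [X in _ - X](bigD1 j) //= jJ !inE eqxx /= l_sub // eqxx.
  rewrite -lex_ge0_difference mulrBl; congr (_ * (_ * _ - _ * _)).
    by apply: eq_bigr => k /andP[kB kj]; rewrite !inE kj.
  by apply: eq_bigr => k /andP[kB kj]; rewrite !inE kj shift_neq.
have LzD : L (z + a j) = L z by rewrite -[in RHS](addrK (a j) z) L_sub.
have lzD k : k \in B -> l k (z + a j) = l k z + (k == j)%:R.
  by move=> kB; rewrite -[in RHS](addrK (a j) z) l_sub // subrK.
rewrite /truncated_opp LzD -mulrBr (bigD1 j) //= [in RHS](bigD1 j) //=.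
rewrite [X in _ - X](bigD1 j) //= jJ !inE eqxx /= lzD // eqxx opprD.
have -> : (half_open_box (b j) (- l j z))%:R =
    (~~ lex_ge0 (b j) (- l j z - 1))%:R - (~~ lex_ge0 (b j) (- l j z))%:R :> rat.
  rewrite -lex_ge0_difference.
  by case: (lex_ge0 _ (_ - 1)); case: lex_ge0; rewrite ?subrr ?subr0 ?sub0r.
rewrite mulrBl; congr (_ * (_ * _ - _ * _)).
  by apply: eq_bigr => k /andP[kB /negPf kj]; rewrite !inE kj /= lzD // kj addr0.
by apply: eq_bigr => k /andP[kB kj]; rewrite !inE kj.
Qed.

Lemma reciprocal_simplicial_cone : reciprocal #|B|
  (fun z => (L z && [forall j in B, lex_ge0 (b j) (l j z)])%:R)
  (fun z => (L z && [forall j in B, ~~ lex_ge0 (b j) (- l j z)])%:R).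
Proof.
apply: reciprocal_ext (reciprocal_truncated (fintype.subxx B)) => z.
  rewrite /truncated -mulnb natrM -prod_bool; congr (_ * _).
  by apply: eq_bigr => j ->.
rewrite /truncated_opp -mulnb natrM -prod_bool; congr (_ * _).
by apply: eq_bigr => j ->.
Qed.

End SimplicialCones.

(** * The cone over a rational polytope and its interior *)

Local Open Scope classical_set_scope.
Local Open Scope ring_scope.

Section ConeGenerators.
Variable R : realType.

Lemma clear_denominators n (v : 'rV[rat]_n) : exists N : int, 0 < N /\
  exists u : 'rV[int]_n,
    map_mx intr u = N%:~R *: map_mx ratr v :> 'rV[R]_n.
Proof.
exists (\prod_k denq (v 0 k)); split.
  by apply: prodr_gt0 => k _; exact: denq_gt0.
exists (\row_k (numq (v 0 k) * \prod_(i | i != k) denq (v 0 i))).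
apply/rowP => k; rewrite !mxE [in RHS](bigD1 k) //= !intrM mulrAC; congr (_ * _).
by rewrite /ratr mulrCA divff ?mulr1 // intr_eq0 denq_neq0.
Qed.

Lemma generated_row r d (V : 'M[R]_(r, d)) j : generated V (row j V).
Proof.
by exists (delta_mx 0 j) => [k|]; rewrite ?mxE ?ler0n // rowE.
Qed.

Lemma generated_sum r d (V : 'M[R]_(r, d)) (I : Type) (t : seq I)
    (l : I -> R) (y : I -> 'rV[R]_d) :
  (forall i, 0 <= l i) -> (forall i, generated V (y i)) ->
  generated V (\sum_(i <- t) l i *: y i).
Proof.
move=> l_ge0 gy; elim/big_rec: _ => [|i x _ gx].
  by exists 0; rewrite ?mul0mx // => j; rewrite mxE.
by apply: generatedD => //; exact: generatedZ.
Qed.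

(** The vertices (v, 1) generate the cone, and positive multiples of them are
    integer vectors. *)
Lemma cone_generators s (P : set 'rV[R]_s) : rational_polytope P ->
  exists r (V : 'M[int]_(r, s + 1)),
    forall y, cone P y <-> generated (map_mx intr V) y.
Proof.
move=> [Vq PE]; pose W : seq 'rV[R]_s := map (map_mx ratr) Vq.
have integral_multiple (j : 'I_(size W)) :
    exists u : 'rV[int]_(s + 1), exists N : R, 0 < N /\
    map_mx intr u = N *: row_mx W`_j 1%:M.
  have [N [N_gt0 [u uE]]] := clear_denominators Vq`_j.
  exists (row_mx u N%:M), N%:~R; split; first by rewrite ltr0z.
  rewrite map_row_mx uE scale_row_mx (nth_map 0) ?map_scalar_mx; last first.
    by apply: leq_trans (ltn_ord j) _; rewrite size_map.
  by rewrite scale_scalar_mx mulr1.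
have [u uE] := choice integral_multiple.
exists (size W), (\matrix_j u j) => y.
set V := map_mx _ _; have rowV j : row j V = map_mx intr (u j).
  by rewrite -map_row rowK.
have gen_vertex (j : 'I_(size W)) : generated V (row_mx W`_j 1%:M).
  have [N [N_gt0 uNE]] := uE j.
  have -> : row_mx W`_j 1%:M = N^-1 *: row j V.
    by rewrite rowV uNE scalerA mulVf ?scale1r // gt_eqF.
  by apply: generatedZ; [rewrite invr_ge0 ltW | exact: generated_row].
split=> [[k [g [l [gP l_ge0 ->]]]]|[mu mu_ge0 ->]].
  apply: generated_sum => // i; have [x Px <-] := gP i.
  move: Px; rewrite PE => -[c [c_ge0 c_sum ->]].
  have -> : row_mx (\sum_j c j *: W`_j) 1%:M = \sum_j c j *: row_mx W`_j 1%:M.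
    under [RHS]eq_bigr do rewrite scale_row_mx scale_scalar_mx mulr1.
    have -> : 1%:M = \sum_j (c j)%:M :> 'M[R]_1 by rewrite -c_sum raddf_sum.
    by elim/big_rec3: _ => [|j y1 y2 y3 _ <-]; rewrite ?row_mx0 // add_row_mx.
  exact: generated_sum.
have [N NE] := choice uE.
exists (size W), (fun j => row_mx W`_j 1%:M), (fun j => mu 0 j * N j); split.
- move=> j; exists W`_j => //; rewrite PE; exists (fun i => (i == j)%:R); split.
  + by move=> i; rewrite ler0n.
  + by rewrite (bigD1 j) //= eqxx big1 ?addr0 // => i /negPf->.
  + rewrite (bigD1 j) //= eqxx scale1r big1 ?addr0 // => i /negPf->.
    by rewrite scale0r.
- by move=> j; have [N_gt0 _] := NE j; rewrite mulr_ge0 // ltW.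
- rewrite mulmx_sum_row; apply: eq_bigr => j _.
  by have [_ uNE] := NE j; rewrite rowV uNE scalerA.
Qed.

(** The kernel of the cokernel of V is a subspace that contains the cone, so
    full dimension forces the cokernel to vanish. *)
Lemma row_full_generators r d (V : 'M[R]_(r, d)) (K : set 'rV[R]_d) :
  (forall y, K y <-> generated V y) -> cone_dim K d -> row_full V.
Proof.
move=> KE [U [_ minU dimU]].
have Ufull : U = fullv.
  by apply/eqP; rewrite eqEdim subvf /= dimvf /dim /= mul1n dimU.
rewrite -cokermx_eq0; set Y := cokermx V.
pose U' := lker (linfun (mulmxr Y : 'rV[R]_d -> 'rV[R]_d)).
have KU' : K `<=` [set` U'].
  move=> y /KE[mu _ ->]; rewrite /= memv_ker lfunE /= -mulmxA mulmx_coker mulmx0.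
  exact: eqxx.
have := minU U' KU'; rewrite Ufull => /subvP allU'.
apply/eqP/row_matrixP => i; rewrite row0 rowE.
have := allU' (delta_mx 0 i) (memvf _).
by rewrite memv_ker lfunE /= => /eqP.
Qed.

(** If x - e b lies in the cone, so does everything near x: a small
    perturbation is a combination of generators with small coefficients, and
    these are absorbed by the positive coefficients of e b. *)
Lemma interior_generated r d (V : 'M[R]_(r, d)) (K : set 'rV[R]_d)
    (tau : 'rV[R]_r) (x : 'rV[R]_d) :
  (forall y, K y <-> generated V y) -> row_full V -> (forall j, 0 < tau 0 j) ->
  interior K x <-> strictly_above V (tau *m V) x.
Proof.
move=> KE fV tau_gt0; set b := tau *m V; split.
- move=> /nbhs_ballP[e /= e_gt0 ballK].
  pose M := \sum_j `|b 0 j|.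
  have M_ge0 : 0 <= M by apply: sumr_ge0 => j _; exact: normr_ge0.
  exists (e / (1 + M)); first by rewrite divr_gt0 //; lra.
  apply/KE/ballK; split=> // i j.
  rewrite (ord1 i) -ball_normE /= !mxE opprB addrCA subrr addr0.
  rewrite normrM gtr0_norm ?divr_gt0 //; last lra.
  rewrite mulrAC ltr_pdivrMr; last lra.
  rewrite ltr_pM2l //; have : `|b 0 j| <= M.
    by rewrite /M (bigD1 j) //= lerDl sumr_ge0.
  rewrite mxE; lra.
- move=> [e e_gt0 [mu mu_ge0 xE]].
  have [C CV] : exists C, C *m V = 1%:M.
    by have [B hB] := exists_basis fV; exists (chart V B); exact: chartK.
  pose M := \sum_k \sum_j `|C k j|.
  have M_ge0 : 0 <= M by do 2!(apply: sumr_ge0 => ? _); exact: normr_ge0.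
  have M1_gt0 : 0 < 1 + M by lra.
  have small (j : 'I_r) : exists2 d0, 0 < d0 &
      forall d1, 0 < d1 -> d1 <= d0 -> d1 * (1 + M) <= e * tau 0 j.
    exists (e * tau 0 j / (1 + M)); first by rewrite divr_gt0 ?mulr_gt0.
    by move=> d1 _; rewrite ler_pdivlMr.
  have [d0 d0_gt0 d0P] := exists_common_small small.
  apply/nbhs_ballP; exists d0 => //= y [_ ball_y]; apply/KE.
  exists (mu + (e *: tau + (y - x) *m C)); last first.
    by rewrite mulmxDl -xE mulmxDl -scalemxAl -mulmxA CV mulmx1 -/b addrA subrK subrKC.
  move=> j; rewrite mxE addr_ge0 // mxE [(e *: tau) 0 j]mxE.
  have le_dM : `|((y - x) *m C) 0 j| <= d0 * M.
    rewrite mxE (le_trans (ler_norm_sum _ _ _)) // /M mulr_sumr ler_sum // => k _.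
    rewrite normrM; apply: (@le_trans _ _ (d0 * `|C k j|)).
      rewrite ler_wpM2r // ltW //; have := ball_y 0 k.
      by rewrite -ball_normE /= distrC !mxE.
    by rewrite ler_pM2l // (bigD1 j) //= lerDl sumr_ge0.
  have := d0P d0 d0_gt0 (lexx _) j; move: le_dM; rewrite ler_norml => /andP[+ _].
  lra.
Qed.

End ConeGenerators.

(** * Ehrhart series *)

Section Exponents.
Variables (R : realType) (s p : nat) (w : 'I_p -> {scalar 'rV[R]_s}).
Hypothesis w_int : forall i (a : 'rV[int]_s), w i (map_mx intr a) \is a Num.int.

(** The exponent vector of the lattice point u. As weights are odd, the series
    of the interior uses the same exponents. *)
Definition exponent (u : 'rV[int]_(s + 1)) : 'rV[int]_(p + (s + 1)) :=
  row_mx (weights w (lsubmx u)) u.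

Lemma weightsB a a' : weights w (a - a') = weights w a - weights w a'.
Proof.
apply/rowP => i; rewrite !mxE; apply: (@intr_inj R).
by rewrite intrB !floorK // map_mxB linearB.
Qed.

Lemma weights0 : weights w 0 = 0.
Proof. by rewrite -[X in weights w X](subrr 0) weightsB subrr. Qed.

Lemma weightsN a : weights w (- a) = - weights w a.
Proof. by rewrite -[X in weights w X]sub0r weightsB weights0 sub0r. Qed.

Lemma exponentB u v : exponent (u - v) = exponent u - exponent v.
Proof. by rewrite /exponent linearB weightsB opp_row_mx add_row_mx. Qed.

Lemma exponentN u : exponent (- u) = - exponent u.
Proof. by rewrite /exponent linearN weightsN opp_row_mx. Qed.

Lemma exponentK : cancel exponent rsubmx.
Proof. by move=> u; rewrite /exponent row_mxKr. Qed.

(** Membership in the image of the exponent map; the second block of the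
    exponent is the lattice point itself. *)
Definition lattice_exponent z := exponent (rsubmx z) == z.

Lemma monomial_seriesE (S : set 'rV[int]_(s + 1)) z :
  monomial_series S exponent z =
  (lattice_exponent z && `[< S (rsubmx z) >])%:R.
Proof.
rewrite /monomial_series /lattice_exponent.
case: (boolP (_ && _)) => [/andP[/eqP ez /asboolP Sz]|nz].
  rewrite (_ : [set u | _] = [set rsubmx z]) ?fsbig_set1 //.
  apply/seteqP; split=> u /= => [[_ <-]|->]; first by rewrite exponentK.
  by split.
rewrite (_ : [set u | _] = set0) ?fsbig_set0 //.
apply/seteqP; split=> u //= -[Su uz]; case/negP: nz.
by rewrite -uz exponentK eqxx; apply/asboolP.
Qed.

End Exponents.

Lemma bounded_rows n M : exists t : seq 'rV[int]_n,
  forall u : 'rV[int]_n, (forall k, (absz (u ord0 k) <= M)%N) -> u \in t.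
Proof.
pose row_of (f : {ffun 'I_n -> 'I_(M + M).+1}) : 'rV[int]_n :=
  \row_k ((f k)%:Z - M%:Z).
exists [seq row_of f | f : {ffun 'I_n -> 'I_(M + M).+1}] => u leM.
apply/fintype.imageP; exists [ffun k => inord (absz (u ord0 k + M%:Z))] => //.
apply/rowP => k; rewrite !mxE ffunE; have := leM k.
have -> : (0 : 'I_1) = ord0 by [].
move: (u ord0 k) => x lexM; rewrite inordK; lia.
Qed.

Section RationalCone.
Variables (R : realType) (s p : nat) (w : 'I_p -> {scalar 'rV[R]_s}).
Hypothesis w_int : forall i (a : 'rV[int]_s), w i (map_mx intr a) \is a Num.int.
Variables (r : nat) (VZ : 'M[int]_(r, s + 1)).

Local Notation V := (map_mx intr VZ : 'M[R]_(r, s + 1)).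
Local Notation real_part z := (map_mx intr (rsubmx z) : 'rV[R]_(s + 1)).

Definition coordinate (B : {set 'I_r}) j (z : 'rV[int]_(p + (s + 1))) : R :=
  (real_part z *m chart V B) 0 j.

(** A point with coordinates in [0, 1] is bounded by the sum of the absolute
    values of the generators. *)
Lemma finite_box B : is_basis V B -> exists t : seq 'rV[int]_(p + (s + 1)),
  forall z, lattice_exponent w z ->
  (forall j, j \in B -> 0 <= coordinate B j z <= 1) -> z \in t.
Proof.
move=> hB; pose M := (\sum_j \sum_k absz (VZ j k))%N.
have [t tP] := bounded_rows (s + 1) M.
exists (map (exponent w) t) => z /eqP zE box_z; rewrite -zE map_f //.
apply: tP => k; rewrite -(ler_nat R) natr_absz.
have -> : `|rsubmx z 0 k|%:~R = `|real_part z 0 k| :> R.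
  by rewrite [in RHS]mxE intr_norm.
rewrite -[real_part z]mulmx1 -(chartK hB) mulmxA mxE.
rewrite (le_trans (ler_norm_sum _ _ _)) // /M natr_sum ler_sum // => j _.
rewrite normrM; have le1 : `|(real_part z *m chart V B) 0 j| <= 1.
  have [jB|jB] := boolP (j \in B); last by rewrite coord_out // normr0.
  by have /andP[ge0 le1] := box_z j jB; rewrite ger0_norm.
apply: le_trans (ler_piMl _ le1) _ => //.
rewrite mxE -intr_norm -natr_absz ler_nat (bigD1 k) //=; exact: leq_addr.
Qed.

Lemma reciprocal_cell B (b : 'rV[R]_(s + 1)) : is_basis V B ->
  reciprocal (s + 1)
    (fun z => (lattice_exponent w z && half_open_cell V b B (real_part z))%:R)
    (fun z => (lattice_exponent w z && opposite_cell V b B (real_part z))%:R).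
Proof.
move=> hB; have [t tP] := finite_box hB.
suff recB k : k = #|B| -> reciprocal k
    (fun z => (lattice_exponent w z && half_open_cell V b B (real_part z))%:R)
    (fun z => (lattice_exponent w z && opposite_cell V b B (real_part z))%:R).
  by apply: recB; rewrite (card_basis hB).
move=> {k} ->.
have coord_sub j k z : j \in B -> k \in B ->
    coordinate B j (z - exponent w (row k VZ)) = coordinate B j z - (j == k)%:R.
  move=> jB kB; rewrite /coordinate linearB /= exponentK map_mxB mulmxBl mxE.
  rewrite [X in _ + X]mxE; congr (_ - _).
  by rewrite map_row -row_mul mxE chart_gen // eq_sym.
apply: (@reciprocal_simplicial_cone _ _ _ B (lattice_exponent w) (coordinate B)
  (fun j => exponent w (row j VZ)) (fun j => (b *m chart V B) 0 j)
  _ _ _ coord_sub _ t tP).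
- by move=> z; rewrite /lattice_exponent linearN exponentN // eqr_opp.
- move=> j z; rewrite /lattice_exponent linearB /= exponentK exponentB //.
  by rewrite (inj_eq (addIr _)).
- by move=> j z; rewrite /coordinate linearN map_mxN mulNmx mxE.
- move=> j jB; apply/eqP => a0; have := coord_sub j j 0 jB jB.
  rewrite a0 subr0 eqxx => /eqP.
  by rewrite -subr_eq0 subKr oner_eq0.
Qed.

End RationalCone.

Theorem theorem2p6 (R : realType) (s p : nat) (P : set 'rV[R]_s)
    (w : 'I_p -> {scalar 'rV[R]_s}) :
  rational_polytope P ->
  cone_dim (cone P) (s + 1) ->
  (forall (i : 'I_p) (a : 'rV[int]_s), w i (map_mx intr a) \is a Num.int) ->
  [/\ exists F : ratfun (p + (s + 1)), represents (ehrhart_series w P) F,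
      exists G : ratfun (p + (s + 1)),
        represents (ehrhart_series_interior w P) G
    & forall F G : ratfun (p + (s + 1)),
        represents (ehrhart_series w P) F ->
        represents (ehrhart_series_interior w P) G ->
        inv_vars F = (-1) ^+ (s + 1) * G].
Proof.
move=> /cone_generators[r [VZ coneE]] dimP w_int.
set V := map_mx _ VZ in coneE.
have fV := row_full_generators coneE dimP.
have [tau tau_gt0 [cells basisP countP]] := half_open_decomposition fV.
have seriesE z : ehrhart_series w P z = \sum_(B <- enum cells)
    (lattice_exponent w z &&
     half_open_cell V (tau *m V) B (map_mx intr (rsubmx z)))%:R.
  rewrite [LHS]monomial_seriesE big_enum /=.
  under eq_bigr do rewrite -mulnb natrM.
  rewrite -mulr_sumr -mulnb natrM; congr (_ * _).
  have [+ _] := countP (map_mx intr (rsubmx z)).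
  rewrite -natr_sum => ->; congr (nat_of_bool _)%:R.
  by apply/asbool_equiv_eq; exact: coneE.
have interiorE z : ehrhart_series_interior w P z = \sum_(B <- enum cells)
    (lattice_exponent w z &&
     opposite_cell V (tau *m V) B (map_mx intr (rsubmx z)))%:R.
  rewrite /ehrhart_series_interior.
  have -> : (fun u => row_mx (- weights w (- lsubmx u)) u) = exponent w.
    by apply/funext => u; rewrite /exponent weightsN // opprK.
  rewrite [LHS]monomial_seriesE big_enum /=.
  under eq_bigr do rewrite -mulnb natrM.
  rewrite -mulr_sumr -mulnb natrM; congr (_ * _).
  have [_ +] := countP (map_mx intr (rsubmx z)).
  rewrite -natr_sum => ->; congr (nat_of_bool _)%:R.
  by apply/asbool_equiv_eq; exact: interior_generated.
have [F0 reprF0 reprG0] : reciprocal (s + 1) (ehrhart_series w P)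
    (ehrhart_series_interior w P).
  apply: (reciprocal_ext (fun z => esym (seriesE z))
                         (fun z => esym (interiorE z))).
  apply: reciprocal_sum => B; rewrite mem_enum => /basisP hB.
  exact: reciprocal_cell.
split; [by exists F0 | by eexists; exact: reprG0 |].
move=> F G reprF reprG.
rewrite (represents_uniq reprF reprF0) (represents_uniq reprG reprG0).
by rewrite mulrA -exprMn mulrNN mulr1 expr1n mul1r.
Qed.
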